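(* There exists a countably infinite partially ordered set $\langle C,\le\rangle$ which is strongly dense but does not have the splitting property. Moreover, this poset can be chosen so that for all $x,y\in C$ with $x<y$ there is an infinite set $Z\subseteq (x,y)=\{z\in C: x<z<y\}$ such that any two distinct elements of $Z$ are incomparable.
   Context: Let $\langle P,\le\rangle$ be a partially ordered set; write $x<y$ for $x\le y$ and $x\neq y$. For $H\subseteq P$ let $\mathcal{D}(H)=\{x\in P:\exists s\in H,\ x\le s\}$ and $\mathcal{U}(H)=\{x\in P:\exists s\in H,\ x\ge s\}$. An antichain is a set of pairwise incomparable elements; an antichain $A$ is maximal if no antichain of $P$ properly contains it. An antichain $A$ splits if there is a partition $\{D,U\}$ of $A$ (into two disjoint sets, possibly empty, with union $A$) such that $P=\mathcal{D}(D)\cup\mathcal{U}(U)$. $P$ has the splitting property if every maximal antichain of $P$ splits. For $x<y$ the open interval is $(x,y)=\{z\in P: x<z<y\}$. $P$ is strongly dense if for every non-empty open interval $(x,y)$ of $P$ there are $z_1,z_2\in(x,y)$ that are incomparable (neither $z_1\le z_2$ nor $z_2\le z_1$). *)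

(* Defs.v *)
From HB Require Import structures.
From mathcomp Require Import all_boot all_order.
From mathcomp Require Import interval.
From mathcomp Require Import boolp classical_sets cardinality set_interval.

Set Implicit Arguments.
Unset Strict Implicit.
Unset Printing Implicit Defensive.

Import Order.TTheory.

Local Open Scope order_scope.
Local Open Scope classical_set_scope.

Section Posets.
Context {d : Order.disp_t} {P : porderType d}.
Implicit Types (A B D H U : set P).

Definition downset H : set P := [set x | exists2 s, H s & x <= s].

Definition upset H : set P := [set x | exists2 s, H s & s <= x].

Definition antichain A : Prop :=
  forall x y, A x -> A y -> x <> y -> x >< y.

Definition maximal_antichain A : Prop :=
  antichain A /\ ~ (exists2 B, antichain B & A `<` B).

(* The parts D and U are allowed to be empty. *)
Definition splits A : Prop :=
  exists D U, [/\ D `&` U = set0, D `|` U = A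
                & downset D `|` upset U = [set: P]].

End Posets.

Definition splitting_property {d : Order.disp_t} (P : porderType d) : Prop :=
  forall A : set P, maximal_antichain A -> splits A.

Definition strongly_dense {d : Order.disp_t} (P : porderType d) : Prop :=
  forall x y : P, x < y -> `]x, y[%classic !=set0 ->
    exists z1 z2 : P, [/\ `]x, y[%classic z1, `]x, y[%classic z2 & z1 >< z2].

(* Main.v *)
Require Import Defs.
From HB Require Import structures.
From mathcomp Require Import all_boot all_order all_algebra.
From mathcomp Require Import interval.
From mathcomp Require Import boolp classical_sets cardinality set_interval.

(**
  If some element [c] is comparable to everything, then [{c}] is a maximal
  antichain, and it can only split if [c] is the least or the greatest element.
  It remains to find a countable poset with such a [c] strictly between two
  other elements and with infinite antichains in all intervals: replace every
  rational except [0] by a countably infinite antichain.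
*)

Set Implicit Arguments.
Unset Strict Implicit.
Unset Printing Implicit Defensive.

Import Order.TTheory GRing.Theory Num.Theory.

Local Open Scope order_scope.
Local Open Scope classical_set_scope.
Local Open Scope card_scope.

Section Posets.
Context {d : Order.disp_t} {P : porderType d}.
Implicit Types (c x y : P) (Z : set P).

Lemma maximal_antichain1 c :
  (forall x, x >=< c) -> maximal_antichain [set c].
Proof.
move=> cmp; split=> [x y -> -> //|[B acB [sub nsub]]].
apply: nsub => x Bx /=; apply: contrapT => xc.
by have := acB _ _ Bx (sub c erefl) xc; rewrite cmp.
Qed.

(** Both parts lie inside [[set c]]. Since [y] is strictly above [c], it can only be covered by
    [upset U], which puts [c] in [U]; dually [x] forces [c] into [D], against disjointness. *)
Lemma not_splits1 x c y : x < c -> c < y -> ~ splits [set c].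
Proof.
move=> xc cy [D [U [DU0 DUc cover]]].
have Dc s : D s -> s = c by move=> Ds; have : [set c] s by rewrite -DUc; left.
have Uc s : U s -> s = c by move=> Us; have : [set c] s by rewrite -DUc; right.
have [[s Ds ys]|[s Us _]] : (downset D `|` upset U) y by rewrite cover.
  by have := lt_le_trans cy ys; rewrite (Dc s Ds) ltxx.
have [[t Dt _]|[t Ut tx]] : (downset D `|` upset U) x by rewrite cover.
  have : (D `&` U) c by split; [rewrite -(Dc t Dt)|rewrite -(Uc s Us)].
  by rewrite DU0.
by have := le_lt_trans tx xc; rewrite (Uc t Ut) ltxx.
Qed.

Lemma infinite_antichain_incomparable Z : infinite_set Z -> antichain Z ->
  exists z1 z2, [/\ Z z1, Z z2 & z1 >< z2].
Proof.
move=> infZ acZ; have [z1 Zz1] := infinite_setN0 infZ.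
have [z2 [Zz2 z21]] : (Z `\ z1) !=set0.
  by apply: infinite_setN0; apply: infinite_setD (finite_set1 _).
by exists z1, z2; split=> //; apply: acZ => // z12; exact: z21.
Qed.

End Posets.

(** The condition keeps every copy [n] of a nonzero rational but only copy 0 of the rational 0. *)
Definition blowup := {p : rat * nat | (p.1 != 0%R) || (p.2 == 0%N)}.

HB.instance Definition _ := Countable.on blowup.

Section Blowup.
Implicit Types x y z : blowup.

Definition height x : rat := (val x).1.

(** The order is given by its strict part: comparing heights by [<=] would not be antisymmetric on a
    fibre. *)
Definition blowup_lt x y := height x < height y.

Fact blowup_lt_irr : irreflexive blowup_lt.
Proof. by move=> x; exact: ltxx. Qed.

Fact blowup_lt_trans : transitive blowup_lt.
Proof. by move=> y x z; exact: lt_trans. Qed.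

Fact blowup_display : Order.disp_t. Proof. exact: Order.Disp tt tt. Qed.

HB.instance Definition _ :=
  Order.Lt_isPOrder.Build blowup_display blowup blowup_lt_irr blowup_lt_trans.

Lemma blowup_ltE x y : (x < y) = (height x < height y).
Proof. by []. Qed.

Lemma blowup_incomparable x y : x != y -> height x = height y -> x >< y.
Proof.
move=> xy hxy; rewrite /Order.comparable !le_eqVlt !blowup_ltE hxy ltxx.
by rewrite [y == x]eq_sym (negPf xy).
Qed.

Definition fibre (q : rat) (q0 : q != 0%R) (n : nat) : blowup :=
  exist _ (q, n) (introT orP (or_introl q0)).

Definition center : blowup := exist _ (0%R, 0%N) isT.

Lemma fibre_inj q (q0 : q != 0%R) : injective (fibre q0).
Proof. by move=> m n []. Qed.

Lemma infinite_fibre q (q0 : q != 0%R) : infinite_set (range (fibre q0)).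
Proof.
apply/infiniteP.
by rewrite (card_le_eqr (inj_card_eq (in2W (fibre_inj (q0 := q0))))) card_lexx.
Qed.

Lemma antichain_fibre q (q0 : q != 0%R) : antichain (range (fibre q0)).
Proof.
by move=> _ _ [m _ <-] [n _ <-] /eqP mn; exact: blowup_incomparable.
Qed.

Lemma center_comparable x : x >=< center.
Proof.
rewrite /Order.comparable !le_eqVlt !blowup_ltE.
have [||h0] := ltgtP (height x) (height center); rewrite ?orbT //.
suff -> : x = center by rewrite eqxx.
apply: val_inj; move: h0; rewrite /height.
(* Over height 0 the subtype condition leaves only the index 0. *)
by case: x => -[q n] /= qn q0; move: qn; rewrite q0 eqxx /= => /eqP ->.
Qed.

Lemma rat_dense_neq0 (a b : rat) : a < b -> exists2 q, q != 0%R & a < q < b.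
Proof.
have mid u v : (u < v :> rat) -> exists m, u < m < v.
  by move=> uv; exists ((u + v) / 2)%R; rewrite !midf_lt.
move=> /mid[m /andP[am mb]].
have [m0|m0] := eqVneq m 0%R; last by exists m; rewrite ?am.
(* If the first midpoint is 0, a point between it and [b] is positive. *)
have [n /andP[mn nb]] := mid _ _ mb.
by exists n; rewrite ?(lt_trans am mn) // -m0 gt_eqF.
Qed.

(** The order sees only heights, so the whole fibre over a nonzero rational strictly between the
    heights of [x] and [y] lies in the interval. *)
Lemma blowup_interval_antichain x y : x < y ->
  exists Z : set blowup,
    [/\ infinite_set Z, Z `<=` `]x, y[%classic & antichain Z].
Proof.
rewrite blowup_ltE => /rat_dense_neq0[q q0 xqy]; exists (range (fibre q0)).
split; [exact: infinite_fibre| |exact: antichain_fibre].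
by move=> _ [n _ <-]; rewrite /= in_itv.
Qed.

End Blowup.

Theorem theorem2p2 :
  exists (d : Order.disp_t) (C : porderType d),
    [/\ [set: C] #= [set: nat],
        strongly_dense C,
        ~ splitting_property C
      & forall x y : C, x < y ->
          exists Z : set C,
            [/\ infinite_set Z, Z `<=` `]x, y[%classic & antichain Z]].
Proof.
exists blowup_display, blowup; split.
- apply: eq_card_nat; first exact: countableP.
  exact: sub_infinite_set (infinite_fibre (q0 := oner_neq0 rat)).
- move=> x y /blowup_interval_antichain[Z [infZ Zxy acZ]] _.
  have [z1 [z2 [Zz1 Zz2 z12]]] := infinite_antichain_incomparable infZ acZ.
  by exists z1, z2; split=> //; exact: Zxy.
- move/(_ _ (maximal_antichain1 center_comparable)).
  have N1 : (- 1)%R != 0%R :> rat by [].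
  (* Points over -1 and 1 show that [center] is neither least nor greatest. *)
  by apply: (@not_splits1 _ _ (fibre N1 0) _ (fibre (oner_neq0 rat) 0)).
- exact: blowup_interval_antichain.
Qed.
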